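(* Let $\Phi=\{4321,\,34512,\,45123,\,35412,\,43512,\,45132,\,45213,\,53412,\,45312,\,45231\}$. Let $w$ be a permutation. If $w$ avoids every pattern in $\Phi$, then $\mathrm{rep}(w)=[321;3412](w)$. Otherwise, $\mathrm{rep}(w)<[321;3412](w)$.
   Context: Permutations $w\in\mathfrak{S}_n$ are written in one-line notation $w(1)w(2)\cdots w(n)$. For $1\le i\le n-1$, $s_i$ denotes the simple reflection (adjacent transposition) interchanging $i$ and $i+1$. The length $\ell(w)$ is the minimal number of simple reflections in an expression $w=s_{i_1}\cdots s_{i_\ell}$; such a minimal expression is a reduced decomposition. The support $\mathrm{supp}(w)$ is the set of distinct simple reflections appearing in a reduced decomposition of $w$ (this is independent of the reduced decomposition chosen). Define $\mathrm{rep}(w)=\ell(w)-|\mathrm{supp}(w)|$. For $p\in\mathfrak{S}_k$, $k\le n$, an occurrence of the pattern $p$ in $w$ is a subsequence $w(i_1)\cdots w(i_k)$ with $i_1<\cdots<i_k$ in the same relative order as $p(1)\cdots p(k)$; $w$ contains $p$ if it has an occurrence of $p$ and avoids $p$ otherwise. $[321;3412](w)$ denotes the number of occurrences of $321$ in $w$ plus the number of occurrences of $3412$ in $w$. *)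

(* Defs.v *)
From mathcomp Require Import all_boot all_order all_algebra all_fingroup.

Set Implicit Arguments.
Unset Strict Implicit.
Unset Printing Implicit Defensive.

Lemma ltn_pred_w n (i : 'I_n.-1) : i < n.
Proof. exact: leq_trans (ltn_ord i) (leq_pred n). Qed.

Lemma ltn_pred_S n (i : 'I_n.-1) : i.+1 < n.
Proof. by case: n i => [|n] [i lt_i]. Qed.

(* Positions and values of a permutation, and hence the indices of simple
   reflections, start at 0 rather than 1. *)
Definition simple n (i : 'I_n.-1) : 'S_n :=
  tperm (Ordinal (ltn_pred_w i)) (Ordinal (ltn_pred_S i)).

(* The product of 'S_n applies its left factor first.  With the opposite
   convention for composition a word becomes its reversal, which changes
   neither the length nor the support below. *)
Definition word_prod n (r : seq 'I_n.-1) : 'S_n := (\prod_(i <- r) simple i)%g.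

Lemma word_prod_cat n (r s : seq 'I_n.-1) :
  word_prod (r ++ s) = (word_prod r * word_prod s)%g.
Proof. exact: big_cat. Qed.

Lemma tperm_word n (d : nat) (x y : 'I_n) :
  y = (x + d)%N :> nat -> exists r, word_prod r = tperm x y.
Proof.
elim: d y => [|d IHd] y def_y.
  exists [::]; rewrite /word_prod big_nil.
  have -> : y = x by apply: val_inj; rewrite /= def_y addn0.
  by rewrite tperm1.
have lt_z: x + d < n.
  by rewrite (leq_trans _ (ltn_ord y)) // def_y addnS ltnS leqnSn.
have lt_i: x + d < n.-1.
  by rewrite ltn_predRL -addnS -def_y ltn_ord.
pose z := Ordinal lt_z; pose i := Ordinal lt_i.
have def_i: simple i = tperm z y.
  by congr tperm; apply: val_inj; rewrite //= def_y addnS.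
have [r def_r] := IHd z (erefl _).
have [d0 | d_gt0] := posnP d.
  exists [:: i]; rewrite /word_prod big_seq1 def_i.
  by congr tperm; apply: val_inj; rewrite /= d0 addn0.
have lt_xz: x < z by rewrite /= -[ltnLHS]addn0 ltn_add2l.
have lt_xy: x < y by rewrite (ltn_trans lt_xz) // def_y /= addnS.
exists (i :: r ++ [:: i]).
rewrite -cat1s !word_prod_cat def_r /word_prod big_seq1 def_i.
rewrite -{1}[tperm z y]tpermV -[LHS]/(tperm x z ^ tperm z y)%g tpermJ tpermL.
by rewrite tpermD // -val_eqE neq_ltn (lt_xz, lt_xy) orbT.
Qed.

Lemma word_exists n (w : 'S_n) : exists r, word_prod r = w.
Proof.
have [ts -> _] := prod_tpermP w.
elim: ts => [|[x y] ts [r def_r]] /=.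
  by exists [::]; rewrite /word_prod !big_nil.
have [s def_s]: exists s, word_prod s = tperm x y.
  have [le_xy | /ltnW le_yx] := leqP x y.
    by apply: (@tperm_word _ (y - x)); rewrite subnKC.
  by rewrite tpermC; apply: (@tperm_word _ (x - y)); rewrite subnKC.
by exists (s ++ r); rewrite big_cons word_prod_cat def_s def_r.
Qed.

Definition has_word n (w : 'S_n) (l : nat) :=
  [exists r : l.-tuple 'I_n.-1, word_prod r == w].

Lemma has_word_exists n (w : 'S_n) : exists l, has_word w l.
Proof.
have [r def_r] := word_exists w.
by exists (size r); apply/existsP; exists (in_tuple r); rewrite /= def_r.
Qed.

Definition len n (w : 'S_n) : nat := ex_minn (has_word_exists w).

Definition reduced n (w : 'S_n) (r : seq 'I_n.-1) :=
  (word_prod r == w) && (size r == len w).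

(* A simple reflection is recorded by its index.  All reduced words of w have
   the same letters, so the choice of the reduced word r is immaterial. *)
Definition supp n (w : 'S_n) : {set 'I_n.-1} :=
  [set i | [exists r : (len w).-tuple 'I_n.-1, reduced w r && (i \in r)]].

(* Integer subtraction, to rule out truncation. *)
Definition rep n (w : 'S_n) : int := ((len w)%:Z - #|supp w|%:Z)%R.

(* A pattern in 'S_k is given by its usual one-line notation, with values
   1, ..., k (only their relative order matters), so that k = size p; an
   occurrence is given by its positions f 0 < ... < f (k - 1). *)
Definition occurrence n (w : 'S_n) (p : seq nat)
    (f : {ffun 'I_(size p) -> 'I_n}) : bool :=
  [forall a : 'I_(size p), forall b : 'I_(size p), (a < b) ==> (f a < f b)] &&
  [forall a : 'I_(size p), forall b : 'I_(size p),
     (w (f a) < w (f b)) == (nth 0 p a < nth 0 p b)].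

Definition occ n (w : 'S_n) (p : seq nat) : nat :=
  #|[set f : {ffun 'I_(size p) -> 'I_n} | occurrence w f]|.

Definition contains n (w : 'S_n) (p : seq nat) : bool :=
  [exists f : {ffun 'I_(size p) -> 'I_n}, occurrence w f].

Definition avoids n (w : 'S_n) (p : seq nat) : bool := ~~ contains w p.

Definition occ_321_3412 n (w : 'S_n) : nat :=
  occ w [:: 3; 2; 1] + occ w [:: 3; 4; 1; 2].

Definition Phi : seq (seq nat) :=
  [:: [:: 4; 3; 2; 1];
      [:: 3; 4; 5; 1; 2];
      [:: 4; 5; 1; 2; 3];
      [:: 3; 5; 4; 1; 2];
      [:: 4; 3; 5; 1; 2];
      [:: 4; 5; 1; 3; 2];
      [:: 4; 5; 2; 1; 3];
      [:: 5; 3; 4; 1; 2];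
      [:: 4; 5; 3; 1; 2];
      [:: 4; 5; 2; 3; 1]].

(* Main.v *)
(* The length of w is its number of inversions, and s_k belongs to the support
   of w iff some inversion straddles the cut between positions k and k + 1.
   Inserting the values of w in increasing order, the value w(p) creates the
   inversions (p, i), and each of them corresponds to a new cut in the support
   unless the cut after i was already straddled by smaller values; so rep(w)
   counts the inversions (p, i) such that there are x <= i < y with
   w(y) < w(x) < w(p).  Call these the repetitions.

   Occurrences of 321 and 3412 whose largest value is at p map to repetitions:
   a 321 at positions (p, x, y) goes to (p, x) if y is the last position holding
   a value smaller than w(x), and to (p, y) otherwise; a 3412 at positions
   (a, p, b, c) goes to (p, b).  This map is onto the repetitions, and the
   patterns of Phi are exactly the shapes formed by two distinct occurrences
   with the same image. *)
Require Import Defs.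
From mathcomp Require Import all_boot all_order all_algebra all_fingroup zify.

Set Implicit Arguments.
Unset Strict Implicit.
Unset Printing Implicit Defensive.

(** * Length and support in terms of inversions *)

Definition inversions n (w : 'S_n) : {set 'I_n * 'I_n} :=
  [set t : 'I_n * 'I_n | (t.1 < t.2) && (w t.2 < w t.1)].

Definition straddled n (w : 'S_n) (k : nat) : bool :=
  [exists x : 'I_n, exists y : 'I_n, (x <= k < y) && (w y < w x)].

Lemma straddledP n (w : 'S_n) k :
  reflect (exists x y : 'I_n, x <= k < y /\ w y < w x) (straddled w k).
Proof.
apply: (iffP existsP) => [[x /existsP[y /andP[? ?]]] | [x [y [xy wxy]]]].
  by exists x, y.
by exists x; apply/existsP; exists y; rewrite xy.
Qed.

Section SimpleReflection.
Variables (n : nat) (i : 'I_n.-1).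

Let lo := Ordinal (ltn_pred_w i).
Let hi := Ordinal (ltn_pred_S i).

Lemma simple_le (k : nat) (x : 'I_n) : k != i -> (simple i x <= k) = (x <= k).
Proof.
move=> ki; rewrite /simple; case: tpermP => [->|->|//] /=; lia.
Qed.

Lemma simple_lt (x y : 'I_n) :
  x < y -> (x, y) != (lo, hi) -> simple i x < simple i y.
Proof.
rewrite xpair_eqE -!val_eqE /simple.
case: (tpermP _ _ x) => [->|->|/eqP + /eqP];
  case: (tpermP _ _ y) => [->|->|/eqP + /eqP]; rewrite -?val_eqE /=; lia.
Qed.

Lemma simpleK : involutive (simple i : 'I_n -> 'I_n).
Proof. exact: tpermK. Qed.

Lemma simple_lo : simple i lo = hi. Proof. exact: tpermL. Qed.
Lemma simple_hi : simple i hi = lo. Proof. exact: tpermR. Qed.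

(** Applying [simple i] to both positions keeps the order of every increasing pair other than
    [(lo, hi)], so it injects the first set into the second. Used for [w] and for [simple i * w],
    this yields an equality. *)
Lemma inversions_simple_sub (w : 'S_n) :
  #|inversions (simple i * w) :\ (lo, hi)| <= #|inversions w :\ (lo, hi)|.
Proof.
pose f (t : 'I_n * 'I_n) := (simple i t.1, simple i t.2).
have f_inj : injective f.
  by move=> [a b] [c d] [/perm_inj -> /perm_inj ->].
rewrite -(card_imset _ f_inj); apply/subset_leq_card/subsetP=> t.
case/imsetP=> -[x y]; rewrite !inE /= !permM => /andP[ne /andP[xy wxy]] ->.
rewrite /f /= simple_lt // wxy !andbT; apply: contraTneq xy => -[e1 e2].
by rewrite -(simpleK x) -(simpleK y) e1 e2 simple_lo simple_hi /= -leqNgt.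
Qed.

(** The pair [(lo, hi)] is the one inversion lost by exchanging the two values; the others
    correspond by the previous lemma. *)
Lemma card_inversions_descent (w : 'S_n) :
  w hi < w lo -> #|inversions w| = #|inversions (simple i * w)|.+1.
Proof.
move=> desc; rewrite (cardsD1 (lo, hi)) [in RHS](cardsD1 (lo, hi)).
rewrite !inE /= !permM simple_lo simple_hi ltnSn desc ltnNge (ltnW desc) /=.
congr _.+1; apply/eqP; rewrite eqn_leq inversions_simple_sub andbT.
have := inversions_simple_sub (simple i * w)%g.
by rewrite mulgA [(simple i * simple i)%g]tperm2 mul1g.
Qed.

Lemma card_inversions_ascent (w : 'S_n) :
  w lo < w hi -> #|inversions (simple i * w)| = #|inversions w|.+1.
Proof.
move=> asc; rewrite card_inversions_descent; last first.
  by rewrite !permM simple_lo simple_hi.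
by rewrite mulgA [(simple i * simple i)%g]tperm2 mul1g.
Qed.

Lemma simple_cases (w : 'S_n) : (w lo < w hi) || (w hi < w lo).
Proof.
by rewrite -neq_ltn val_eqE (inj_eq perm_inj) -val_eqE /= neq_ltn ltnSn.
Qed.

End SimpleReflection.

Lemma word_prod_cons n i (r : seq 'I_n.-1) :
  word_prod (i :: r) = (simple i * word_prod r)%g.
Proof. exact: big_cons. Qed.

Lemma inversions1 n : inversions (1 : 'S_n) = set0.
Proof. by apply/setP => -[x y]; rewrite !inE /= !perm1; lia. Qed.

Lemma card_inversions_word n (r : seq 'I_n.-1) :
  #|inversions (word_prod r)| <= size r.
Proof.
elim: r => [|i r IHr]; first by rewrite /word_prod big_nil inversions1 cards0.
rewrite word_prod_cons /=; set w := word_prod r in IHr *.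
case/orP: (simple_cases i w) => [/card_inversions_ascent | desc].
  by move=> ->; rewrite ltnS.
by move: IHr; rewrite (card_inversions_descent desc) => /ltnW/leq_trans; apply.
Qed.

Lemma no_descent_id n (w : 'S_n) :
  (forall x y : 'I_n, y = x.+1 :> nat -> w x < w y) -> w = 1%g.
Proof.
move=> asc.
(* Induction from the left end gives [x <= w x]; [high], by induction from the right end, gives
   [w x <= x]. *)
have low k : forall x : 'I_n, x = k :> nat -> k <= w x.
  elim: k => // k IHk x xk; have lt_k : k < n by have := ltn_ord x; lia.
  have le_k := IHk (Ordinal lt_k) (erefl _).
  exact: leq_ltn_trans le_k (asc (Ordinal lt_k) _ xk).
have high k : forall x : 'I_n, x + k.+1 = n -> w x + k.+1 <= n.
  elim: k => [|k IHk] x xk; first by rewrite addn1 ltn_ord.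
  have lt_x : x.+1 < n by lia.
  have := IHk (Ordinal lt_x); rewrite /= addSnnS xk => /(_ (erefl _)).
  by have := asc x (Ordinal lt_x) (erefl _); lia.
apply/permP => x; apply: val_inj; rewrite perm1 /=.
have := low _ x (erefl _); have := high (n - x.+1) x; have := ltn_ord x; lia.
Qed.

(** Bubble sort: each exchange at a descent removes exactly one inversion, and only the identity has
    no descent. *)
Lemma inversions_word n (w : 'S_n) :
  exists2 r : seq 'I_n.-1, word_prod r = w & size r = #|inversions w|.
Proof.
have [m] := ubnP #|inversions w|; elim: m w => // m IHm w le_m.
have [/existsP[i desc] | /existsPn asc] := boolP [exists i : 'I_n.-1,
    w (Ordinal (ltn_pred_S i)) < w (Ordinal (ltn_pred_w i))].
  have cardE := card_inversions_descent desc.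
  have [|r def_r size_r] := IHm (simple i * w)%g; first lia.
  exists (i :: r); last by rewrite cardE /= size_r.
  by rewrite word_prod_cons def_r mulgA /simple tperm2 mul1g.
have w1 : w = 1%g.
  apply: no_descent_id => x y xy.
  have lt_x : x < n.-1 by have := ltn_ord y; lia.
  have := asc (Ordinal lt_x).
  case/orP: (simple_cases (Ordinal lt_x) w) => [+ _ | ->] //.
  by congr (w _ < w _); apply: val_inj; rewrite /= ?xy.
by exists [::]; rewrite w1 ?inversions1 ?cards0 // /word_prod big_nil.
Qed.

Lemma lenE n (w : 'S_n) : len w = #|inversions w|.
Proof.
rewrite /len; case: ex_minnP => l /existsP[r /eqP def_w] min_l.
apply/eqP; rewrite eqn_leq -{2}def_w -{3}(size_tuple r) card_inversions_word.
have [s def_s size_s] := inversions_word w; rewrite andbT min_l //.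
by apply/existsP; rewrite -size_s; exists (in_tuple s); rewrite /= def_s.
Qed.

Lemma word_prod_le n (r : seq 'I_n.-1) (k : 'I_n.-1) (x : 'I_n) :
  k \notin r -> (word_prod r x <= k) = (x <= k).
Proof.
elim: r x => [|i r IHr] x; first by rewrite /word_prod big_nil perm1.
rewrite inE negb_or => /andP[ki kr].
by rewrite word_prod_cons permM IHr // simple_le.
Qed.

(** Without the letter [k], the product permutes the positions up to [k] among themselves, so
    nothing straddles the cut. Conversely, in a reduced word each letter [i] creates an inversion
    astride its own cut, and letters in front of it keep some inversion astride that cut. *)
Lemma mem_reduced_word n (r : seq 'I_n.-1) (k : 'I_n.-1) :
  size r = #|inversions (word_prod r)| ->
  (k \in r) = straddled (word_prod r) k.
Proof.
move=> red_r; apply/idP/straddledP => [|[x [y [/andP[xk ky] wxy]]]]; last first.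
  apply: contraLR wxy => kr; have := word_prod_le x kr.
  have := word_prod_le y kr; lia.
elim: r red_r => // i r IHr; rewrite word_prod_cons /= => red_r.
have le_r := card_inversions_word r; set w := word_prod r in le_r IHr red_r *.
(* If the first letter were a descent of the rest, the rest would have more inversions than
   letters. *)
have [asc cardE]: w (Ordinal (ltn_pred_w i)) < w (Ordinal (ltn_pred_S i)) /\
    #|inversions w| = size r.
  case/orP: (simple_cases i w) => [asc | desc].
    by split=> //; have := card_inversions_ascent asc; rewrite -red_r => -[].
  by move: le_r; rewrite (card_inversions_descent desc) -red_r ltnNge leqnSn.
rewrite inE; have [-> _ | ki /= kr] := eqVneq k i.
  exists (Ordinal (ltn_pred_w i)), (Ordinal (ltn_pred_S i)).
  by rewrite !permM simple_lo simple_hi /= leqnn ltnSn.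
have [|x [y [xky wxy]]] := IHr _ kr; first exact: esym.
exists (simple i x), (simple i y); rewrite !permM !simpleK; split=> //.
by rewrite ltnNge !simple_le // -ltnNge.
Qed.

Lemma suppE n (w : 'S_n) : supp w = [set k : 'I_n.-1 | straddled w k].
Proof.
apply/setP => k; rewrite !inE; apply/existsP/idP => [[[s size_s]] | strad].
  case/andP=> /andP[/eqP def_w _] ks.
  by rewrite -def_w -mem_reduced_word // def_w (eqP size_s) lenE.
have [r def_w size_r] := inversions_word w.
have size_rP : size r == len w by rewrite size_r lenE.
exists (Tuple size_rP); rewrite /reduced /= def_w eqxx size_rP.
by rewrite mem_reduced_word ?def_w.
Qed.

(** * Repetitions as the excess of length over support *)

Lemma card_pairs (T U : finType) (A : {set T * U}) :
  #|A| = \sum_x #|[set y | (x, y) \in A]|.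
Proof.
rewrite -sum1_card; under [RHS]eq_bigr => x _ do rewrite -sum1_card.
by rewrite pair_big_dep /=; apply: eq_bigl => -[x y]; rewrite inE.
Qed.

Section Repetitions.
Variables (n : nat) (w : 'S_n).

(* In the subword of w formed by its values below m, the positions i such that
   an inversion of that subword straddles the cut just after i. *)
Definition straddlers (m : nat) : {set 'I_n} :=
  [set i : 'I_n | (w i < m) && [exists x : 'I_n, exists y : 'I_n,
     (x <= i < y) && (w y < w x < m)]].

Lemma straddlersP m (i : 'I_n) :
  reflect (w i < m /\ exists x y : 'I_n, x <= i < y /\ w y < w x < m)
          (i \in straddlers m).
Proof.
rewrite inE; apply: (iffP andP) => -[wi].
  by case/existsP=> x /existsP[y /andP[? ?]]; split=> //; exists x, y.
case=> x [y [xy wxy]]; split=> //.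
by apply/existsP; exists x; apply/existsP; exists y; rewrite xy.
Qed.

Definition repetitions : {set 'I_n * 'I_n} :=
  [set t : 'I_n * 'I_n | (t.1 < t.2) && (t.2 \in straddlers (w t.1))].

(* When the value w p is inserted, the cuts to the left of p keep their status,
   while those after p and after every later position but the last become
   straddled, provided that some position follows p. *)
Lemma card_straddlersS (p : 'I_n) :
  #|straddlers (w p).+1| + #|[set i | (p, i) \in repetitions]| =
  #|straddlers (w p)| + #|[set i | (p, i) \in inversions w]|.
Proof.
set A := straddlers (w p); set B := [set i | _].
set L := [set i | _ \in inversions _].
have LE i : (i \in L) = (p < i) && (w i < w p) by rewrite !inE.
have BE i : (i \in B) = (p < i) && (i \in A) by rewrite !inE.
pose C := [set i : 'I_n | i < p].
have CE i : (i \in C) = (i < p) by rewrite inE.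
(* The position [p] itself is not in [A], its value not being below [w p]; so [A] splits into a part
   left of [p] and a part right of it, the latter being [B]. *)
have AE : #|A| = #|A :&: C| + #|B|.
  rewrite -(cardsID C A); congr (_ + _).
  apply: eq_card => i; rewrite BE in_setD CE -leqNgt.
  rewrite leq_eqVlt; have [/val_inj <-|//] := eqVneq (p : nat) i.
  by rewrite ltnn; apply/negP => /straddlersP[]; rewrite ltnn.
suff -> : #|straddlers (w p).+1| = #|A :&: C| + #|L|.
  by rewrite AE addnAC.
(* A new inversion has the largest value [w p] as its left entry, so it straddles no cut before
   [p]. *)
have lowE (i : 'I_n) : i < p -> (i \in straddlers (w p).+1) = (i \in A).
  move=> ip; apply/straddlersP/straddlersP=> -[wi [x [y [xy wxy]]]]; last first.
    by split; [lia | exists x, y; split; lia].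
  have neq (z : 'I_n) : z < p -> w z < (w p).+1 -> w z < w p.
    rewrite ltnS [_ <= w p]leq_eqVlt => zp /orP[/eqP/val_inj/perm_inj e|//].
    by rewrite e ltnn in zp.
  split; first exact: neq ip wi.
  have := neq x; exists x, y; split; lia.
(* From [p] on, [p] can serve as the left end, so any smaller value beyond [i] gives a straddling
   inversion. *)
have highE (i : 'I_n) : p <= i ->
    (i \in straddlers (w p).+1) =
    ((i == p) || (i \in L)) && [exists y in L, i < y].
  move=> pi.
  apply/straddlersP/andP=> [[wi [x [y [xy wxy]]]] | [iL /exists_inP]].
    split; last by apply/exists_inP; exists y; rewrite ?LE; lia.
    rewrite -val_eqE LE /=; have [e|] := eqVneq (w i : nat) (w p).
      by rewrite (perm_inj (val_inj e)) eqxx.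
    have [//|/=] := eqVneq (i : nat) p; lia.
  case=> y; rewrite LE => /andP[py wy] iy; split.
    by move: iL; rewrite LE => /orP[/eqP->|/andP[_]]; lia.
  by exists p, y; split; lia.
have [L0 | /set0Pn[l0 l0L]] := eqVneq L set0.
  rewrite L0 cards0 addn0; apply: eq_card => i; rewrite in_setI CE.
  have [ip|pi] := ltnP i p; first by rewrite andbT lowE.
  rewrite andbF highE // andbC; apply/negP => /andP[/exists_inP[y]].
  by rewrite L0 inE.
(* Among [p] and the positions of [L], only the last one, [l], is not straddled. Thus [p] makes up
   for [l], and the part from [p] on has as many elements as [L]. *)
pose l := [arg max_(i > l0 in L) (i : nat)].
have [lL max_l] : l \in L /\ forall i, i \in L -> i <= l.
  by rewrite /l; case: arg_maxnP.
have lastE (i : 'I_n) : i \in p |: L -> [exists y in L, i < y] = (i != l).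
  move=> iL; apply/exists_inP/idP=> [[y yL iy] | il].
    by have := max_l y yL; apply: contraTneq => <-; rewrite -ltnNge.
  exists l => //; move: iL il; rewrite -val_eqE in_setU1 => /orP[/eqP->|iL] /=.
    by move: lL; rewrite LE => /andP[].
  by have := max_l i iL; lia.
rewrite (cardsD1 l L) lL.
have -> : straddlers (w p).+1 =
    (A :&: C) :|: (p |: (L :\ l)).
  apply/setP => i; rewrite in_setU in_setI in_setU1 in_setD1 CE.
  have [ip|pi] := ltnP i p.
    rewrite lowE // LE andbT.
    have -> : (i == p) = false by apply/negbTE; rewrite neq_ltn ip.
    by rewrite [p < i]ltnNge ltnW //= andbF orbF.
  rewrite andbF highE //=; have [iL|] := boolP ((i == p) || (i \in L)).
    rewrite lastE ?in_setU1 //=; case/orP: iL => [/eqP->|->]; last first.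
      have [->|] := eqVneq i l => //=; last by rewrite orbT.
      by rewrite -val_eqE; move: lL; rewrite LE /=; lia.
    by rewrite eqxx -val_eqE; move: lL; rewrite LE /=; lia.
  by rewrite negb_or => /andP[/negbTE-> /negbTE->]; rewrite andbF.
have dis : (A :&: C) :&: (p |: L :\ l) = set0.
  apply/setP => i; rewrite in_set0 !in_setI CE in_setU1 in_setD1 LE -val_eqE /=.
  lia.
rewrite cardsU dis cards0 subn0.
by rewrite cardsU1 in_setD1 LE ltnn andbF.
Qed.

(** Sum the previous identity over all [p]. As [w p] runs through all values, the numbers of
    straddlers telescope from the empty set at [0] to the support at [n]. *)
Lemma card_repetitions : #|inversions w| = #|supp w| + #|repetitions|.
Proof.
have -> : #|supp w| = #|straddlers n|.
  have widen_inj : injective (fun k : 'I_n.-1 => Ordinal (ltn_pred_w k)).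
    by move=> j k /(congr1 val) /= /val_inj.
  rewrite -(card_imset _ widen_inj) suppE; apply: eq_card => i.
  apply/imsetP/straddlersP => [[k] | [_ [x [y [xy /andP[wxy _]]]]]].
    rewrite inE => /straddledP[x [y [xy wxy]]] ->; split; first exact: ltn_ord.
    by exists x, y; rewrite wxy ltn_ord.
  have lt_i : i < n.-1 by have := ltn_ord y; lia.
  exists (Ordinal lt_i); last exact: val_inj.
  by rewrite inE; apply/straddledP; exists x, y.
have : \sum_p (#|straddlers (w p).+1| + #|[set i | (p, i) \in repetitions]|) =
    \sum_p (#|straddlers (w p)| + #|[set i | (p, i) \in inversions w]|).
  by apply: eq_bigr => p _; exact: card_straddlersS.
rewrite !big_split /= -!card_pairs.
have S0 : #|straddlers 0| = 0.
  by apply: eq_card0 => i; apply/negP => /straddlersP[].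
have reindexE (F : nat -> nat) : \sum_p F (w p) = \sum_(0 <= m < n) F m.
  by rewrite big_mkord [RHS](reindex_perm w).
have telescope : \sum_p #|straddlers (w p).+1| =
    \sum_p #|straddlers (w p)| + #|straddlers n|.
  rewrite (reindexE (fun m => #|straddlers m.+1|)).
  rewrite (reindexE (fun m => #|straddlers m|)).
  by rewrite -big_nat_recr // big_nat_recl //= S0.
rewrite telescope -addnA => /addnI <-.
by [].
Qed.

(** * Occurrences of patterns as tuples of positions *)

Lemma occurrenceP (p : seq nat) (f : {ffun 'I_(size p) -> 'I_n}) : uniq p ->
  reflect ((forall a b : 'I_(size p), a < b -> f a < f b) /\
           (forall a b : 'I_(size p),
              nth 0 p a < nth 0 p b -> w (f a) < w (f b)))
          (occurrence w f).
Proof.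
move=> uniq_p; apply: (iffP andP) => -[mono pat]; split.
- by move=> a b ab; move/forallP: mono => /(_ a)/forallP/(_ b); rewrite ab.
- by move=> a b ab; move/forallP: pat => /(_ a)/forallP/(_ b)/eqP ->.
- by apply/forallP => a; apply/forallP => b; apply/implyP/mono.
apply/forallP => a; apply/forallP => b; apply/eqP.
have [lt_ab | lt_ba | eq_ab] := ltngtP (nth 0 p a) (nth 0 p b).
- exact: pat.
- by apply/negbTE; rewrite -leqNgt ltnW // pat.
have -> : a = b.
  apply: val_inj; apply/eqP.
  by rewrite -(nth_uniq 0 (ltn_ord a) (ltn_ord b) uniq_p) eq_ab.
by rewrite ltnn.
Qed.

Lemma containsI (p : seq nat) (s : seq 'I_n) x : uniq p ->
  (forall a b, a < b -> b < size p -> nth x s a < nth x s b) ->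
  (forall a b, a < size p -> b < size p -> nth 0 p a < nth 0 p b ->
     w (nth x s a) < w (nth x s b)) ->
  contains w p.
Proof.
move=> uniq_p mono pat; apply/existsP.
exists [ffun a : 'I_(size p) => nth x s a].
by apply/occurrenceP => //; split=> a b ab; rewrite !ffunE ?mono ?pat.
Qed.

Lemma containsE (p : seq nat) : uniq p -> 0 < size p -> contains w p ->
  exists F : nat -> 'I_n,
    (forall a b, a < b < size p -> F a < F b) /\
    (forall a b, [&& a < size p, b < size p & nth 0 p a < nth 0 p b] ->
       w (F a) < w (F b)).
Proof.
move=> uniq_p p_gt0 /existsP[f /occurrenceP[] // mono pat].
(* Indices outside the pattern default to index 0, so that [F] is total and can be applied to
   numerals. *)
pose o := insubd (Ordinal p_gt0); exists (f \o o).
have oE a : a < size p -> o a = a :> nat by move=> ?; rewrite insubdK.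
split=> a b /andP[]; first by move=> ab bp; apply: mono; rewrite !oE //; lia.
by move=> ap /andP[bp ab]; apply: pat; rewrite !oE.
Qed.

Definition occs321 : {set 'I_n * 'I_n * 'I_n} :=
  [set t : 'I_n * 'I_n * 'I_n | let: (p, x, y) := t in
     (p < x < y) && (w y < w x < w p)].

Definition occs3412 : {set 'I_n * 'I_n * 'I_n * 'I_n} :=
  [set t : 'I_n * 'I_n * 'I_n * 'I_n | let: (a, p, b, c) := t in
     [&& a < p, p < b & b < c] && [&& w b < w c, w c < w a & w a < w p]].

Lemma occ321E : occ w [:: 3; 2; 1] = #|occs321|.
Proof.
pose o k (lt_k : k < 3) : 'I_(size [:: 3; 2; 1]) := Ordinal lt_k.
pose h (f : {ffun 'I_(size [:: 3; 2; 1]) -> 'I_n}) :=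
  (f (@o 0 isT), f (@o 1 isT), f (@o 2 isT)).
have h_inj : injective h.
  move=> f g [e0 e1 e2]; apply/ffunP => -[[|[|[|//]]] lt_k].
  - by rewrite (_ : Ordinal lt_k = @o 0 isT) //; apply: val_inj.
  - by rewrite (_ : Ordinal lt_k = @o 1 isT) //; apply: val_inj.
  - by rewrite (_ : Ordinal lt_k = @o 2 isT) //; apply: val_inj.
rewrite /occ -(card_imset _ h_inj); apply: eq_card => -[[x y] z].
rewrite inE; apply/imsetP/idP => [[f] | xyz].
  rewrite inE => /occurrenceP[//|mono pat] [-> -> ->].
  by rewrite !mono ?pat.
exists [ffun a : 'I_(size [:: 3; 2; 1]) => nth x [:: x; y; z] a]; last first.
  by rewrite /h !ffunE.
rewrite inE; apply/occurrenceP => //.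
by split=> -[[|[|[|//]]] ?] [[|[|[|//]]] ?] //= _; rewrite !ffunE /=; lia.
Qed.

Lemma occ3412E : occ w [:: 3; 4; 1; 2] = #|occs3412|.
Proof.
pose o k (lt_k : k < 4) : 'I_(size [:: 3; 4; 1; 2]) := Ordinal lt_k.
pose h (f : {ffun 'I_(size [:: 3; 4; 1; 2]) -> 'I_n}) :=
  (f (@o 0 isT), f (@o 1 isT), f (@o 2 isT), f (@o 3 isT)).
have h_inj : injective h.
  move=> f g [e0 e1 e2 e3]; apply/ffunP => -[[|[|[|[|//]]]] lt_k].
  - by rewrite (_ : Ordinal lt_k = @o 0 isT) //; apply: val_inj.
  - by rewrite (_ : Ordinal lt_k = @o 1 isT) //; apply: val_inj.
  - by rewrite (_ : Ordinal lt_k = @o 2 isT) //; apply: val_inj.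
  - by rewrite (_ : Ordinal lt_k = @o 3 isT) //; apply: val_inj.
rewrite /occ -(card_imset _ h_inj); apply: eq_card => -[[[x y] z] t].
rewrite inE; apply/imsetP/idP => [[f] | xyz].
  rewrite inE => /occurrenceP[//|mono pat] [-> -> -> ->].
  by rewrite !mono ?pat.
exists [ffun a : 'I_(size [:: 3; 4; 1; 2]) => nth x [:: x; y; z; t] a];
  last first.
  by rewrite /h !ffunE.
rewrite inE; apply/occurrenceP => //.
by split=> -[[|[|[|[|//]]]] ?] [[|[|[|[|//]]]] ?] //= _; rewrite !ffunE /=; lia.
Qed.

Notation triple := ('I_n * 'I_n * 'I_n)%type.
Notation quadruple := ('I_n * 'I_n * 'I_n * 'I_n)%type.
Notation occurrences := (triple + quadruple)%type.

Definition occs : {set occurrences} :=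
  [set o : occurrences |
     match o with inl t => t \in occs321 | inr t => t \in occs3412 end].

Lemma card_occs : #|occs| = occ_321_3412 w.
Proof.
have inl_inj : injective (@inl triple quadruple) by move=> ? ? [].
have inr_inj : injective (@inr triple quadruple) by move=> ? ? [].
have disj : inl @: occs321 :&: inr @: occs3412 = set0 :> {set occurrences}.
  by apply/setP => -[t|t]; rewrite in_setI in_set0; apply/negP => /andP[];
    [move=> _ | move=> + _] => /imsetP[].
rewrite /occ_321_3412 occ321E occ3412E -(card_imset _ inl_inj).
rewrite -(card_imset _ inr_inj) -cardsUI disj cards0 addn0.
apply: eq_card => -[t|t]; rewrite inE in_setU mem_imset //.
  by case: imsetP => [[? _ []] // | _]; rewrite orbF.
by case: imsetP => [[? _ []] // | _].
Qed.

(** * The map from occurrences to repetitions and its image *)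

Definition last_smaller (x y : 'I_n) : bool :=
  [forall z : 'I_n, (y < z) ==> (w x < w z)].

Definition repetition_of (o : occurrences) : 'I_n * 'I_n :=
  match o with
  | inl (p, x, y) => (p, if last_smaller x y then x else y)
  | inr (a, p, b, c) => (p, b)
  end.

Lemma last_smallerPn (x y : 'I_n) : x < y ->
  reflect (exists2 z : 'I_n, y < z & w z < w x) (~~ last_smaller x y).
Proof.
move=> xy; apply: (iffP forallPn) => -[z].
  rewrite negb_imply -leqNgt => /andP[yz]; rewrite leq_eqVlt.
  case/orP=> [/eqP/val_inj/perm_inj e | ]; first by move: xy yz; rewrite e; lia.
  by exists z.
by move=> yz zx; exists z; rewrite negb_imply yz -leqNgt ltnW.
Qed.

Lemma last_smaller_exists (x y : 'I_n) : x < y -> w y < w x ->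
  exists2 z : 'I_n, x < z & (w z < w x) && last_smaller x z.
Proof.
move=> xy wxy; pose z := [arg max_(i > y | (x < i) && (w i < w x)) (i : nat)].
have [/andP[xz wz] max_z] : (x < z) && (w z < w x) /\
    forall i : 'I_n, (x < i) && (w i < w x) -> i <= z.
  by rewrite /z; case: arg_maxnP => //; rewrite xy.
exists z; rewrite // wz; apply/negPn/negP => /last_smallerPn[//|t zt wt].
by have := max_z t; lia.
Qed.

Lemma repetition_of_imset : repetition_of @: occs = repetitions.
Proof.
apply/setP => -[p i]; rewrite [RHS]inE /=; apply/imsetP/andP.
  case=> -[[[q x] y] | [[[a q] b] c]]; rewrite inE /= inE.
    case/andP=> /andP[qx xy] /andP[wxy wq] [-> ->].
    (* The cut after [x] is straddled by [(x, y)]; the cut after [y] is straddled by [(x, z)] as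
       soon as a later [z] has a value below [w x]. *)
    have [_|/last_smallerPn[//|z yz wz]] := boolP (last_smaller x y).
      split=> //; apply/straddlersP; split=> //.
      by exists x, y; rewrite leqnn xy wxy.
    split; first exact: ltn_trans xy.
    apply/straddlersP; split; first exact: ltn_trans wq.
    by exists x, z; rewrite ltnW // yz wz.
  case/andP=> /and3P[aq qb bc] /and3P[wbc wca waq] [-> ->]; split=> //.
  apply/straddlersP; split; first lia.
  by exists a, c; split; lia.
case=> pi /straddlersP[wi [x [y [/andP[xi iy] /andP[wyx wxp]]]]].
(* If a value below [w i] follows [i], the last such position completes a 321 with [i] in the
   middle. *)
have [/existsP[z /andP[iz wzi]] | /existsPn no_inv] :=
  boolP [exists z : 'I_n, (i < z) && (w z < w i)].
  have [t it /andP[wt last_t]] := last_smaller_exists iz wzi.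
  by exists (inl (p, i, t)); rewrite ?inE /= ?last_t //; lia.
have wiy : w i < w y.
  have := no_inv y; rewrite iy /= -leqNgt leq_eqVlt => /orP[/eqP|//].
  by move/val_inj/perm_inj => e; rewrite e ltnn in iy.
have lt_xi : x < i.
  rewrite ltn_neqAle xi andbT; apply/eqP => /val_inj e.
  by move: wyx wiy; rewrite e; lia.
have xp : x != p :> nat by apply/eqP => /val_inj e; rewrite e ltnn in wxp.
(* Now [w i < w y < w x < w p] and [x < i < y]. If [x] precedes [p], this is a 3412; otherwise
   [(p, x, i)] is a 321, and [y] shows that [i] is not the last position with a value below
   [w x]. *)
have [lt_px | le_xp] := ltnP p x; last first.
  by exists (inr (x, p, i, y)); rewrite ?inE //=; lia.
exists (inl (p, x, i)); first by rewrite !inE; lia.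
by rewrite /= ifN //; apply/last_smallerPn => //; exists y.
Qed.

(** * Patterns of [Phi] give colliding occurrences *)

Definition names_repetition (o : occurrences) (t : 'I_n * 'I_n) :=
  o \in occs /\ repetition_of o = t.

Lemma names_3412 (a p b c : 'I_n) :
  [&& a < p, p < b & b < c] -> [&& w b < w c, w c < w a & w a < w p] ->
  names_repetition (inr (a, p, b, c)) (p, b).
Proof. by move=> pos val; split=> //; rewrite !inE pos val. Qed.

Lemma names_321r (p x y z : 'I_n) :
  [&& p < x, x < y & y < z] -> [&& w y < w x, w z < w x & w x < w p] ->
  names_repetition (inl (p, x, y)) (p, y).
Proof.
move=> /and3P[px xy yz] /and3P[wy wz wx]; split; first by rewrite !inE; lia.
by rewrite /= ifN //; apply/last_smallerPn => //; exists z.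
Qed.

(** To have image [(p, x)], the 321 must end at the last position with a value below [w x], which
    may lie beyond [y]; hence the existential [t]. *)
Lemma names_321l (p x y : 'I_n) :
  p < x < y -> w y < w x < w p ->
  exists t, names_repetition (inl (p, x, t)) (p, x).
Proof.
move=> /andP[px xy] /andP[wy wx].
have [t xt /andP[wt last_t]] := last_smaller_exists xy wy.
by exists t; split; rewrite ?inE /= ?inE ?last_t //; lia.
Qed.

Lemma not_inj_of_contains q : q \in Phi -> contains w q ->
  ~ {in occs &, injective repetition_of}.
Proof.
move=> q_Phi w_q inj.
have names_inj o o' t : names_repetition o t -> names_repetition o' t -> o = o'.
  by move=> [o_in ot] [o'_in o't]; apply: inj; rewrite ?ot.
have /andP[uniq_q q_gt0] : uniq q && (0 < size q).
  by move: q q_Phi {w_q}; apply/allP.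
have [F [pos val]] := containsE uniq_q q_gt0 w_q.
have neq (x y : 'I_n) : x < y -> x <> y by move=> + e; rewrite e ltnn.
have p0 := pos 0 1; have p1 := pos 1 2; have p2 := pos 2 3; have p3 := pos 3 4.
move: q_Phi p0 p1 p2 p3 val {uniq_q q_gt0 w_q pos}; rewrite !inE.
case/or4P=> [||| /or4P[||| /or4P[|||]]].
all: try case/orP.
all: move=> /eqP-> /(_ isT) p0 /(_ isT) p1 /(_ isT) p2 p3 val.
(* The pattern 4321 has only four positions, so [p3] is available only for the other patterns. *)
all: try (have {}p3 := p3 isT).
all: have n01 := neq _ _ p0; have n12 := neq _ _ p1; have n23 := neq _ _ p2.
all: try (have n34 := neq _ _ p3).
(* One case per pattern, in the order of [Phi]. The [v]s list the values in increasing order; then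
   two occurrences with the same image are exhibited, and they differ because the positions [F k]
   are distinct. *)
- have v1 := val 3 2 isT; have v2 := val 2 1 isT; have v3 := val 1 0 isT.
  have [t names_t] := @names_321l (F 0) (F 2) (F 3) ltac:(lia) ltac:(lia).
  have := names_inj _ _ _ names_t
    (@names_321r (F 0) (F 1) (F 2) (F 3) ltac:(lia) ltac:(lia)).
  by congruence.
- have v1 := val 3 4 isT; have v2 := val 4 0 isT; have v3 := val 0 1 isT.
  have v4 := val 1 2 isT.
  have := names_inj _ _ _
    (@names_3412 (F 0) (F 2) (F 3) (F 4) ltac:(lia) ltac:(lia))
    (@names_3412 (F 1) (F 2) (F 3) (F 4) ltac:(lia) ltac:(lia)).
  by congruence.
- have v1 := val 2 3 isT; have v2 := val 3 4 isT; have v3 := val 4 0 isT.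
  have v4 := val 0 1 isT.
  have := names_inj _ _ _
    (@names_3412 (F 0) (F 1) (F 2) (F 3) ltac:(lia) ltac:(lia))
    (@names_3412 (F 0) (F 1) (F 2) (F 4) ltac:(lia) ltac:(lia)).
  by congruence.
- have v1 := val 3 4 isT; have v2 := val 4 0 isT; have v3 := val 0 2 isT.
  have v4 := val 2 1 isT.
  have := names_inj _ _ _
    (@names_3412 (F 0) (F 1) (F 3) (F 4) ltac:(lia) ltac:(lia))
    (@names_321r (F 1) (F 2) (F 3) (F 4) ltac:(lia) ltac:(lia)).
  by congruence.
- have v1 := val 3 4 isT; have v2 := val 4 1 isT; have v3 := val 1 0 isT.
  have v4 := val 0 2 isT.
  have := names_inj _ _ _
    (@names_3412 (F 0) (F 2) (F 3) (F 4) ltac:(lia) ltac:(lia))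
    (@names_3412 (F 1) (F 2) (F 3) (F 4) ltac:(lia) ltac:(lia)).
  by congruence.
- have v1 := val 2 4 isT; have v2 := val 4 3 isT; have v3 := val 3 0 isT.
  have v4 := val 0 1 isT.
  have := names_inj _ _ _
    (@names_3412 (F 0) (F 1) (F 2) (F 3) ltac:(lia) ltac:(lia))
    (@names_3412 (F 0) (F 1) (F 2) (F 4) ltac:(lia) ltac:(lia)).
  by congruence.
- have v1 := val 3 2 isT; have v2 := val 2 4 isT; have v3 := val 4 0 isT.
  have v4 := val 0 1 isT.
  have [t names_t] := @names_321l (F 1) (F 2) (F 3) ltac:(lia) ltac:(lia).
  have := names_inj _ _ _ names_t
    (@names_3412 (F 0) (F 1) (F 2) (F 4) ltac:(lia) ltac:(lia)).
  by congruence.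
- have v1 := val 3 4 isT; have v2 := val 4 1 isT; have v3 := val 1 2 isT.
  have v4 := val 2 0 isT.
  have := names_inj _ _ _
    (@names_321r (F 0) (F 1) (F 3) (F 4) ltac:(lia) ltac:(lia))
    (@names_321r (F 0) (F 2) (F 3) (F 4) ltac:(lia) ltac:(lia)).
  by congruence.
- have v1 := val 3 4 isT; have v2 := val 4 2 isT; have v3 := val 2 0 isT.
  have v4 := val 0 1 isT.
  have := names_inj _ _ _
    (@names_3412 (F 0) (F 1) (F 3) (F 4) ltac:(lia) ltac:(lia))
    (@names_321r (F 1) (F 2) (F 3) (F 4) ltac:(lia) ltac:(lia)).
  by congruence.
- have v1 := val 4 2 isT; have v2 := val 2 3 isT; have v3 := val 3 0 isT.
  have v4 := val 0 1 isT.
  have [t names_t] := @names_321l (F 1) (F 2) (F 4) ltac:(lia) ltac:(lia).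
  have := names_inj _ _ _ names_t
    (@names_3412 (F 0) (F 1) (F 2) (F 3) ltac:(lia) ltac:(lia)).
  by congruence.
Qed.

(** * Colliding occurrences give patterns of [Phi] *)

Lemma contains4 p (x0 x1 x2 x3 : 'I_n) :
  uniq p -> size p = 4 -> [&& x0 < x1, x1 < x2 & x2 < x3] ->
  (forall a b, a < 4 -> b < 4 -> nth 0 p a < nth 0 p b ->
     w (nth x0 [:: x0; x1; x2; x3] a) < w (nth x0 [:: x0; x1; x2; x3] b)) ->
  contains w p.
Proof.
move=> uniq_p size_p pos val.
apply: (@containsI _ [:: x0; x1; x2; x3] x0) => //.
  by rewrite size_p => -[|[|[|[|a]]]] [|[|[|[|b]]]] //=; lia.
by rewrite size_p.
Qed.

Lemma contains5 p (x0 x1 x2 x3 x4 : 'I_n) :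
  uniq p -> size p = 5 -> [&& x0 < x1, x1 < x2, x2 < x3 & x3 < x4] ->
  (forall a b, a < 5 -> b < 5 -> nth 0 p a < nth 0 p b ->
     w (nth x0 [:: x0; x1; x2; x3; x4] a) <
     w (nth x0 [:: x0; x1; x2; x3; x4] b)) ->
  contains w p.
Proof.
move=> uniq_p size_p pos val.
apply: (@containsI _ [:: x0; x1; x2; x3; x4] x0) => //.
  by rewrite size_p => -[|[|[|[|[|a]]]]] [|[|[|[|[|b]]]]] //=; lia.
by rewrite size_p.
Qed.

Ltac pattern4 p x0 x1 x2 x3 :=
  exists p; [done | apply: (@contains4 _ x0 x1 x2 x3) => //; first lia];
  move=> [|[|[|[|?]]]] [|[|[|[|?]]]] //= *; lia.
Ltac pattern5 p x0 x1 x2 x3 x4 :=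
  exists p; [done | apply: (@contains5 _ x0 x1 x2 x3 x4) => //; first lia];
  move=> [|[|[|[|[|?]]]]] [|[|[|[|[|?]]]]] //= *; lia.

Lemma val_cases (x y : 'I_n) : x < y -> (w x < w y) || (w y < w x).
Proof.
by move=> xy; rewrite -neq_ltn val_eqE (inj_eq perm_inj) -val_eqE neq_ltn xy.
Qed.

Lemma collision_321_321 p x y x' y' :
  inl (p, x, y) \in occs -> inl (p, x', y') \in occs -> (x, y) != (x', y') ->
  repetition_of (inl (p, x, y)) = repetition_of (inl (p, x', y')) ->
  exists2 q, q \in Phi & contains w q.
Proof.
rewrite !inE /= => /andP[/andP[px xy] /andP[wy wx]].
move=> /andP[/andP[px' xy'] /andP[wy' wx']] ne [].
have [/forallP last | /last_smallerPn[//|z yz wz]] := boolP (last_smaller x y);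
have [/forallP last' | /last_smallerPn[//|z' yz' wz']] :=
  boolP (last_smaller x' y').
(* Both third positions would be the last one with a value below [w x], so they coincide. *)
- move=> e; subst x'; move: ne; rewrite xpair_eqE eqxx /= -val_eqE neq_ltn.
  by case/orP=> lt_y; [have := last y' | have := last' y]; rewrite lt_y /=; lia.
- by move=> e; subst y'; pattern4 [:: 4; 3; 2; 1] p x' x y.
- by move=> e; subst y; pattern4 [:: 4; 3; 2; 1] p x x' y'.
move=> e; subst y'.
(* The two 321s share [p] and [y] and differ in the middle. Unless 4321 appears, [w x < w x'] and
   [w y < w z], where [z] is the later position with a value below [w x]. *)
move: ne; rewrite xpair_eqE eqxx andbT -val_eqE neq_ltn => ne.
wlog lt_x : x x' z z' px px' xy xy' wy wx wy' wx' wz wz' yz yz' {ne} / x < x'.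
  by move=> IH; case/orP: ne; [apply: (IH x x' z z') | apply: (IH x' x z' z)].
have [lt_w | gt_w] := orP (val_cases lt_x); last first.
  by pattern4 [:: 4; 3; 2; 1] p x x' y.
have [lt_yz | gt_yz] := orP (val_cases yz); last first.
  by pattern4 [:: 4; 3; 2; 1] p x y z.
by pattern5 [:: 5; 3; 4; 1; 2] p x x' y z.
Qed.

Lemma collision_321_3412 p x y a p' b c :
  inl (p, x, y) \in occs -> inr (a, p', b, c) \in occs ->
  repetition_of (inl (p, x, y)) = repetition_of (inr (a, p', b, c)) ->
  exists2 q, q \in Phi & contains w q.
Proof.
rewrite !inE /= => /andP[/andP[px xy] /andP[wy wx]].
move=> /andP[/and3P[ap pb bc] /and3P[wb wc wa]] [e]; subst p'.
have [/forallP last | /last_smallerPn[//|z yz wz]] := boolP (last_smaller x y).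
  (* Here [w y < w x < w c], so [y] and [c] differ and only their order matters. *)
  move=> e; subst b; case: (ltngtP y c) => [yc | cy | /val_inj e].
  - by pattern5 [:: 4; 5; 2; 1; 3] a p x y c.
  - by pattern5 [:: 4; 5; 2; 3; 1] a p x c y.
  by subst y; lia.
move=> e; subst b.
(* Now [x] lies between [p] and [y], and the pattern depends on where [w x] falls relative to
   [w c < w a]. *)
have [lt_w | gt_w] := orP (val_cases (ltn_trans ap px)); last first.
  have [lt_w' | gt_w'] := orP (val_cases (ltn_trans xy bc)).
    by pattern5 [:: 4; 5; 2; 1; 3] a p x y c.
  by pattern5 [:: 4; 5; 3; 1; 2] a p x y c.
by pattern5 [:: 3; 5; 4; 1; 2] a p x y c.
Qed.

Lemma collision_3412_3412 a p b c a' p' b' c' :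
  inr (a, p, b, c) \in occs -> inr (a', p', b', c') \in occs ->
  (a, p, b, c) != (a', p', b', c') ->
  repetition_of (inr (a, p, b, c)) = repetition_of (inr (a', p', b', c')) ->
  exists2 q, q \in Phi & contains w q.
Proof.
rewrite !inE /= => /andP[/and3P[ap pb bc] /and3P[wb wc wa]].
move=> /andP[/and3P[ap' pb' bc'] /and3P[wb' wc' wa']] ne [e e']; subst p' b'.
have [eq_a | ] := eqVneq a a'.
  subst a'; move: ne; rewrite xpair_eqE eqxx /= -val_eqE neq_ltn => ne.
  wlog lt_c : c c' bc bc' wb wb' wc wc' {ne} / c < c'.
    by move=> IH; case/orP: ne; [apply: (IH c c') | apply: (IH c' c)].
  have [lt_w | gt_w] := orP (val_cases lt_c).
    by pattern5 [:: 4; 5; 1; 2; 3] a p b c c'.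
  by pattern5 [:: 4; 5; 1; 3; 2] a p b c c'.
rewrite -val_eqE neq_ltn {ne} => ne.
wlog lt_a : a a' c c' ap ap' bc bc' wb wb' wc wc' wa wa' {ne} / a < a'.
  by move=> IH; case/orP: ne; [apply: (IH a a' c c') | apply: (IH a' a c' c)].
(* The last position is taken from the occurrence with the smaller first value, so that its value is
   below both [w a] and [w a']. *)
have [lt_w | gt_w] := orP (val_cases lt_a).
  by pattern5 [:: 3; 4; 5; 1; 2] a a' p b c.
by pattern5 [:: 4; 3; 5; 1; 2] a a' p b c'.
Qed.

Lemma inj_of_avoids : (forall q, q \in Phi -> avoids w q) ->
  {in occs &, injective repetition_of}.
Proof.
move=> avoid o o' o_in o'_in e; apply/eqP/negPn/negP => ne.
suff [q q_Phi] : exists2 q, q \in Phi & contains w q.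
  by apply/negP; exact: avoid.
case: o o_in e ne => [[[p x] y] | [[[a p] b] c]] o_in e ne;
case: o' o'_in e ne => [[[p' x'] y'] | [[[a' p'] b'] c']] o'_in e ne.
- have /= [pp' _] := e; subst p'.
  apply: collision_321_321 o_in o'_in _ e.
  by apply: contraNneq ne => -[-> ->].
- exact: collision_321_3412 o_in o'_in e.
- exact: collision_321_3412 o'_in o_in (esym e).
apply: collision_3412_3412 o_in o'_in _ e.
by apply: contraNneq ne => ->.
Qed.

End Repetitions.

Theorem theorem3p2 (n : nat) (w : 'S_n) :
  ((forall p : seq nat, p \in Phi -> avoids w p) ->
     rep w = (occ_321_3412 w)%:Z%R) /\
  (~ (forall p : seq nat, p \in Phi -> avoids w p) ->
     (rep w < (occ_321_3412 w)%:Z)%R).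
Proof.
have -> : rep w = #|repetitions w|%:Z%R.
  by rewrite /rep lenE card_repetitions PoszD GRing.addrAC GRing.subrr
    GRing.add0r.
(* Now [rep w] is the size of the image of [occs]: at most that of [occs], with equality exactly
   when the map is injective there. *)
rewrite -repetition_of_imset -card_occs; split=> [avoid | contain].
  by rewrite card_in_imset //; apply: inj_of_avoids.
rewrite ltz_nat ltn_neqAle leq_imset_card andbT.
apply/negP => /imset_injP inj; apply: contain => q q_Phi.
by apply/negP => /(not_inj_of_contains q_Phi).
Qed.
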